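(* Let $q$ be a prime power and $n\ge 4$. The Grassmann graph $J_q(n,2)$ is separating if and only if $n$ is odd.
   Context: $J_q(n,2)$ is the graph whose vertices are the $2$-dimensional subspaces of $\mathbb{F}_q^n$, two being adjacent if they intersect in a $1$-dimensional subspace. A graph $\Gamma$ is separating if $\omega(\Gamma)\alpha(\Gamma)<|V(\Gamma)|$, where $\omega$ and $\alpha$ are the maximum clique and coclique sizes. *)

(* Defs.v *)
From HB Require Import structures.
From mathcomp Require Import all_boot all_order all_algebra.
Set Implicit Arguments.
Unset Strict Implicit.
Unset Printing Implicit Defensive.
Import VectorInternalTheory.

Record sgraph := SGraph {
  vertex :> finType;
  adj : rel vertex;
  adj_sym : symmetric adj;
  adj_irr : irreflexive adj
}.

Section Separating.
Variable G : sgraph.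
Implicit Type A : {set G}.

Definition clique A : bool :=
  [forall x in A, forall y in A, (x != y) ==> adj x y].

Definition coclique A : bool :=
  [forall x in A, forall y in A, ~~ adj x y].

(* The empty set is a clique and a coclique, so both maxima are attained. *)
Definition omega : nat := \max_(A : {set G} | clique A) #|A|.
Definition alpha : nat := \max_(A : {set G} | coclique A) #|A|.

Definition separating : bool := omega * alpha < #|G|.
End Separating.

(* Subspaces are encoded as row-reduced matrices, so over a finite field they
   form a finite type; the library provides only their choice structure. *)
HB.instance Definition _ (F : finFieldType) (vT : vectType F) :=
  [Countable of {vspace vT} by <:].
HB.instance Definition _ (F : finFieldType) (vT : vectType F) :=
  [Finite of {vspace vT} by <:].

Section Grassmann.
Variables (F : finFieldType) (n : nat).

Definition plane : predArgType := {U : {vspace 'rV[F]_n} | \dim U == 2}.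
HB.instance Definition _ := Finite.on plane.

Definition plane_adj : rel plane :=
  fun U V => \dim (val U :&: val V)%VS == 1.

Lemma plane_adj_sym : symmetric plane_adj.
Proof. by move=> U V; rewrite /plane_adj capvC. Qed.

Lemma plane_adj_irr : irreflexive plane_adj.
Proof. by move=> [U dU]; rewrite /plane_adj /= capvv (eqP dU). Qed.

Definition grassmann2 : sgraph := SGraph plane_adj_sym plane_adj_irr.
End Grassmann.

(* Main.v *)
Require Import Defs.
From mathcomp Require Import all_boot all_order all_algebra all_field.
From mathcomp Require Import zify.
(** Count pairs (vector, plane).  The planes through a line L partition the
    vectors outside L, so there are d = (q^n - q) / (q^2 - q) of them, and the
    number N of planes satisfies N (q^2 - 1) = (q^n - 1) d.  A clique either has
    a common line or lies in a 3-space, whence omega = d when n >= 4.  Hence the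
    graph is separating iff alpha (q^2 - 1) < q^n - 1.  The planes of a coclique
    share no nonzero vector, so "<=" always holds; if n is odd, q^2 - 1 does not
    divide q^n - 1 and the inequality is strict.  If n is even, take a matrix J
    with J^2 = J + b, where X^2 - X - b has no root: the J-invariant planes
    partition the nonzero vectors, and equality holds. *)

Set Implicit Arguments.
Unset Strict Implicit.
Unset Printing Implicit Defensive.
Import GRing.Theory.

Section Planes.
Variables (F : finFieldType) (n : nat).
Local Notation q := #|F|.
Local Notation V := 'rV[F]_n.
Implicit Types (L W : {vspace V}) (U : plane F n) (A : {set plane F n}).

Lemma plane_inj U U' : val U = val U' -> U = U'.
Proof. exact: val_inj. Qed.

(** * Incidences between vectors and planes *)

Definition points W : {set V} := [set v | v \in W].

Lemma card_points W : #|points W| = q ^ \dim W.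
Proof. by rewrite cardsE card_vspace. Qed.

Lemma card_points_diff L W :
  (L <= W)%VS -> #|points W :\: points L| = q ^ \dim W - q ^ \dim L.
Proof.
move=> sLW; rewrite cardsDS ?card_points //.
by apply/subsetP=> v; rewrite !inE; apply/subvP.
Qed.

Lemma dim_fullv : \dim (fullv : {vspace V}) = n.
Proof. by rewrite dimvf dim_matrix [LHS]mul1n. Qed.

Lemma double_count A (S : {set V}) :
  \sum_(U in A) #|points (val U) :&: S|
    = \sum_(v in S) #|[set U in A | v \in val U]|.
Proof.
under eq_bigr do rewrite -sum1_card.
rewrite (exchange_big_dep (mem S)) /=; last by move=> U v _ /setIP[].
apply: eq_bigr => v Sv; rewrite -sum1_card; apply: eq_bigl => U.
by rewrite !inE [_ \in S]Sv andbT.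
Qed.

(** Each plane of [A] has [q ^ 2 - q ^ \dim L] vectors outside [L], all in [W]. Below, [L] is a line
    (planes on a line) or [0] (nonzero vectors). *)
Lemma incidence A L W : (forall U, U \in A -> (L <= val U <= W)%VS) ->
  #|A| * (q ^ 2 - q ^ \dim L)
    = \sum_(v in points W :\: points L) #|[set U in A | v \in val U]|.
Proof.
move=> sLAW; rewrite -double_count -sum_nat_const.
apply: eq_bigr => U /sLAW/andP[sLU sUW].
rewrite -[in LHS](eqP (valP U)) -card_points_diff //.
apply: eq_card => v; rewrite !inE andbCA; congr (_ && _).
by case: (boolP (v \in val U)) => [Uv | _]; rewrite ?(subvP sUW _ Uv) ?andbF.
Qed.

Lemma incidence_le A L W c : (L <= W)%VS ->
    (forall U, U \in A -> (L <= val U <= W)%VS) ->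
    (forall v, v \in W -> v \notin L -> #|[set U in A | v \in val U]| <= c) ->
  #|A| * (q ^ 2 - q ^ \dim L) <= (q ^ \dim W - q ^ \dim L) * c.
Proof.
move=> sLW sLAW lec; rewrite (incidence sLAW) -card_points_diff //.
rewrite -sum_nat_const leq_sum // => v; rewrite !inE => /andP[Lv Wv].
exact: lec.
Qed.

Lemma incidence_ge A L c :
    (forall U, U \in A -> (L <= val U)%VS) ->
    (forall v, v \notin L -> c <= #|[set U in A | v \in val U]|) ->
  (q ^ n - q ^ \dim L) * c <= #|A| * (q ^ 2 - q ^ \dim L).
Proof.
move=> sLA gec; have sLAW U : U \in A -> (L <= val U <= fullv)%VS.
  by rewrite subvf andbT; apply: sLA.
have -> : q ^ n = q ^ \dim (fullv : {vspace V}) by rewrite dim_fullv.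
rewrite (incidence sLAW) -card_points_diff ?subvf //.
rewrite -sum_nat_const leq_sum // => v; rewrite !inE => /andP[Lv _].
exact: gec.
Qed.

(** * Planes through a line, and the number of planes *)

Lemma dim_line_add L v : \dim L = 1 -> v \notin L -> \dim (L + <[v]>) == 2.
Proof.
move=> dL Lv; rewrite dimv_disjoint_sum ?dL ?dim_vline.
  by case: (eqVneq v 0%R) Lv => [-> | //]; rewrite mem0v.
apply/eqP; rewrite -subv0; apply/subvP=> w; rewrite memv_cap memv0.
case/andP=> Lw /vlineP[k Dw]; apply: contraNT Lv => w0.
have k0 : k != 0%R by apply: contraNneq w0 => k0; rewrite Dw k0 scale0r.
by rewrite -[v](scalerK k0) -Dw memvZ.
Qed.

Lemma plane_spanned L v U : \dim L = 1 -> v \notin L ->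
  (L <= val U)%VS -> v \in val U -> val U = (L + <[v]>)%VS.
Proof.
move=> dL Lv sLU Uv; apply/esym/eqP.
by rewrite eqEdim subv_add sLU -memvE Uv (eqP (dim_line_add dL Lv)) (eqP (valP U)).
Qed.

Definition star L : {set plane F n} := [set U | (L <= val U)%VS].

Lemma card_star_through L v A : \dim L = 1 -> v \notin L -> A \subset star L ->
  #|[set U in A | v \in val U]| <= 1.
Proof.
move=> dL Lv /subsetP sA; apply/card_le1_eqP => U U'.
rewrite !inE => /andP[/sA + Uv] /andP[/sA + U'v]; rewrite !inE => LU LU'.
by apply: plane_inj; rewrite (plane_spanned dL Lv LU Uv) (plane_spanned dL Lv LU' U'v).
Qed.

Lemma card_substar L W A : \dim L = 1 -> (L <= W)%VS ->
    (forall U, U \in A -> (L <= val U <= W)%VS) ->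
  #|A| * (q ^ 2 - q) <= q ^ \dim W - q.
Proof.
move=> dL sLW sLAW; have := @incidence_le A L W 1 sLW sLAW.
rewrite dL muln1 expn1; apply=> v _ Lv; apply: (card_star_through dL Lv).
by apply/subsetP=> U /sLAW/andP[]; rewrite inE.
Qed.

Lemma card_star L : \dim L = 1 -> #|star L| * (q ^ 2 - q) = q ^ n - q.
Proof.
move=> dL; apply/eqP; rewrite eqn_leq; apply/andP; split.
  have -> : q ^ n = q ^ \dim (fullv : {vspace V}) by rewrite dim_fullv.
  by apply: card_substar (subvf L) _ => // U; rewrite inE subvf andbT.
have := @incidence_ge (star L) L 1; rewrite dL muln1 expn1; apply.
  by move=> U; rewrite inE.
move=> v Lv; apply/card_gt0P; exists (Sub (L + <[v]>)%VS (dim_line_add dL Lv)).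
by rewrite !inE /= addvSl memvE addvSr.
Qed.

(** The planes on a nonzero [v] form the star of [<[v]>], so counting nonzero vectors reduces to
    [card_star]; its factor [q ^ 2 - q] stays on the left to avoid division. *)
Lemma card_planes :
  #|plane F n| * (q ^ 2 - 1) * (q ^ 2 - q) = (q ^ n - 1) * (q ^ n - q).
Proof.
have sA U : U \in [set: plane F n] -> (0 <= val U <= fullv)%VS.
  by rewrite sub0v subvf.
have := incidence sA; rewrite dimv0 expn0 cardsT => ->.
have := card_points_diff (sub0v (fullv : {vspace V})).
rewrite dim_fullv dimv0 expn0 => <-; rewrite -sum_nat_const big_distrl /=.
apply: eq_bigr => v; rewrite !inE memv0 => /andP[v0 _].
rewrite -(@card_star <[v]>) ?dim_vline ?v0 //.
by congr (_ * _); apply: eq_card => U; rewrite !inE memvE.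
Qed.

(** * Adjacency and cliques *)

Lemma adjP U U' : reflect (U != U' /\ exists2 v, v != 0%R & v \in val U /\ v \in val U')
  (plane_adj U U').
Proof.
apply: (iffP idP) => [adjUU' | [neUU' [v v0 [Uv U'v]]]].
  split; first by apply: contraTneq adjUU' => ->; rewrite plane_adj_irr.
  exists (vpick (val U :&: val U')); last by apply/andP; rewrite -memv_cap memv_pick.
  by rewrite vpick0 -dimv_eq0 (eqP adjUU').
have sv : (<[v]> <= val U :&: val U')%VS by rewrite -memvE memv_cap Uv.
rewrite /plane_adj eqn_leq; apply/andP; split; last first.
  by rewrite (leq_trans _ (dimvS sv)) // dim_vline v0.
rewrite leqNgt; apply: contra neUU' => dI; apply/eqP/plane_inj.
have eqI (X : plane F n) : (val U :&: val U' <= val X)%VS -> (val U :&: val U')%VS = val X.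
  by move=> sIX; apply/eqP; rewrite eqEdim sIX (eqP (valP X)).
exact: etrans (esym (eqI U (capvSl _ _))) (eqI U' (capvSr _ _)).
Qed.

Lemma cliqueP (A : {set grassmann2 F n}) : reflect
  (forall U U', U \in A -> U' \in A -> U != U' -> plane_adj U U') (clique A).
Proof.
apply: (iffP forall_inP) => [cA U U' AU AU' | cA U AU].
  by apply/implyP; move/forall_inP: (cA U AU); apply.
by apply/forall_inP=> U' AU'; apply/implyP; apply: cA.
Qed.

Lemma cocliqueP (A : {set grassmann2 F n}) : reflect
  (forall U U', U \in A -> U' \in A -> ~~ plane_adj U U') (coclique A).
Proof.
apply: (iffP forall_inP) => [cA U U' AU | cA U AU].
  by move/forall_inP: (cA U AU); apply.
by apply/forall_inP=> U' AU'; apply: cA.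
Qed.

Lemma star_clique L : \dim L = 1 -> @clique (grassmann2 F n) (star L).
Proof.
move=> dL; apply/cliqueP=> U U'; rewrite !inE => LU LU' neUU'.
apply/adjP; split=> //; exists (vpick L).
  by rewrite vpick0 -dimv_eq0 dL.
by split; apply: subvP (memv_pick L).
Qed.

(** A nonzero vector lies on at most [q + 1] planes of [W], so [A] has at most [q ^ 2 + q + 1]
    members. The bound is written as the star count in dimension 4, for comparison with stars when
    [4 <= n]. *)
Lemma card_planes_in_solid W A : \dim W = 3 ->
  (forall U, U \in A -> (val U <= W)%VS) -> #|A| * (q ^ 2 - q) <= q ^ 4 - q.
Proof.
move=> dW sAW; have q1 := finNzRing_gt1 F.
have := @incidence_le A 0%VS W q.+1; rewrite dimv0 dW sub0v => /(_ isT) H.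
have {H} : #|A| * (q ^ 2 - q ^ 0) <= (q ^ 3 - q ^ 0) * q.+1.
  apply: H => [U /sAW sUW | v Wv]; first by rewrite sub0v sUW.
  rewrite memv0 => v0.
  have dv : \dim <[v]> = 1 by rewrite dim_vline v0.
  have := @card_substar <[v]> W [set U in A | v \in val U] dv.
  rewrite -memvE dW => /(_ Wv) H.
  have {H} : #|[set U in A | v \in val U]| * (q ^ 2 - q) <= q ^ 3 - q.
    by apply: H => U; rewrite inE -memvE => /andP[/sAW -> ->].
  have -> : q ^ 3 - q = q.+1 * (q ^ 2 - q).
    rewrite !expnS expn0; nia.
  by rewrite leq_pmul2r // subn_gt0 -[X in X < _]expn1 ltn_exp2l.
set a := #|A|; set r := q in q1 *; move=> le1.
(* Uses [(r ^ 2 - r) * (r + 1) = (r ^ 2 - 1) * r]. *)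
have : (a * (r ^ 2 - r)) * r.+1 <= (r ^ 4 - r) * r.+1.
  have -> : a * (r ^ 2 - r) * r.+1 = a * (r ^ 2 - r ^ 0) * r.
    by rewrite !expnS expn0 -!mulnA; congr (_ * _); nia.
  have -> : r ^ 4 - r = (r ^ 3 - r ^ 0) * r by rewrite mulnBl -expnSr expn0 mul1n.
  by rewrite [X in _ <= X]mulnAC leq_mul2r le1 orbT.
by rewrite leq_pmul2r.
Qed.

Lemma subv_line L v W : \dim L = 1 -> v != 0%R -> v \in L -> v \in W -> (L <= W)%VS.
Proof.
move=> dL v0 Lv; have /eqP<- : <[v]>%VS == L by rewrite eqEdim -memvE Lv dim_vline v0 dL.
by rewrite -memvE.
Qed.

(** Vectors that [U3] shares with [U1] and with [U2] are independent, since otherwise [U3] would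
    contain the line [U1 :&: U2]; hence they span [U3]. *)
Lemma third_plane U1 U2 U3 :
    plane_adj U1 U2 -> plane_adj U1 U3 -> plane_adj U2 U3 ->
  ~~ (val U1 :&: val U2 <= val U3)%VS -> (val U3 <= val U1 + val U2)%VS.
Proof.
move=> /eqP dp /adjP[_ [v1 v10 [U1v1 U3v1]]] /adjP[_ [v2 v20 [U2v2 U3v2]]] npU3.
have dv1 : \dim <[v1]> = 1 by rewrite dim_vline v10.
have nv2 : v2 \notin <[v1]>%VS.
  apply: contra npU3 => /vlineP[k Dv2]; apply: (subv_line dp v20) => //.
  by rewrite memv_cap U2v2 Dv2 memvZ.
rewrite (plane_spanned dv1 nv2 _ U3v2) -?memvE //.
by apply: addvS; rewrite -memvE.
Qed.

Lemma card_clique (A : {set grassmann2 F n}) : 4 <= n -> clique A ->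
  #|A| * (q ^ 2 - q) <= q ^ n - q.
Proof.
move=> n4 /cliqueP cA; have q1 := finNzRing_gt1 F.
have [A1 | ] := leqP #|A| 1.
  rewrite (leq_trans (leq_mul A1 (leqnn _))) // mul1n leq_sub2r //.
  by rewrite leq_exp2l // (leq_trans _ n4).
case/card_gt1P=> U1 [U2 [AU1 AU2 ne12]].
have adj12 := cA _ _ AU1 AU2 ne12; have /eqP dp := adj12.
have [/forall_inP pA | /forall_inPn[U3 AU3 npU3]] :=
    boolP [forall U in A, val U1 :&: val U2 <= val U]%VS.
  rewrite -[in X in _ <= X]dim_fullv; apply: (card_substar dp) => [|U AU].
    exact: subvf.
  by rewrite pA ?subvf.
have ne_of U U' : (val U1 :&: val U2 <= val U)%VS ->
    ~~ (val U1 :&: val U2 <= val U')%VS -> U != U' :> plane F n.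
  by move=> pU; apply: contraNneq => <-.
have outside U : U \in A -> ~~ (val U1 :&: val U2 <= val U)%VS ->
    (val U <= val U1 + val U2)%VS.
  move=> AU npU; apply: (third_plane adj12 _ _ npU).
    exact: (cA _ _ AU1 AU (ne_of _ _ (capvSl _ _) npU)).
  exact: (cA _ _ AU2 AU (ne_of _ _ (capvSr _ _) npU)).
have dW : \dim (val U1 + val U2) = 3.
  by have := dimv_sum_cap (val U1) (val U2); rewrite dp (eqP (valP U1)) (eqP (valP U2)); lia.
apply: (@leq_trans (q ^ 4 - q)); last by rewrite leq_sub2r // leq_exp2l.
apply: (card_planes_in_solid dW) => U AU.
(* A plane of [A] on the common line meets [U3] off that line, and [U3] lies in the 3-space; line
   and meeting vector span the plane. *)
have [pU | npU] := boolP (val U1 :&: val U2 <= val U)%VS; last exact: outside.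
have /adjP[_ [v v0 [Uv U3v]]] := cA _ _ AU AU3 (ne_of _ _ pU npU3).
have npv : v \notin (val U1 :&: val U2)%VS.
  by apply: contra npU3 => pv; apply: subv_line dp v0 pv U3v.
rewrite (plane_spanned dp npv pU Uv) subv_add (subv_trans (capvSl _ _)) ?addvSl //=.
by rewrite -memvE (subvP (outside _ AU3 npU3)).
Qed.

Lemma omega_star L : 4 <= n -> \dim L = 1 -> omega (grassmann2 F n) = #|star L|.
Proof.
move=> n4 dL; apply/eqP; rewrite eqn_leq; apply/andP; split; last first.
  exact: (leq_bigmax_cond _ (star_clique dL)).
apply/bigmax_leqP=> A cA; have := card_clique n4 cA.
rewrite -(card_star dL) leq_pmul2r // subn_gt0 -[X in X < _]expn1 ltn_exp2l //.
exact: finNzRing_gt1.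
Qed.

Lemma omega_grassmann2 : 4 <= n ->
  omega (grassmann2 F n) * (q ^ 2 - q) = q ^ n - q.
Proof.
move=> n4; pose v : V := const_mx 1%R.
have v0 : v != 0%R.
  apply/eqP=> /rowP/(_ (Ordinal (leq_trans (ltn0Sn 3) n4))).
  by rewrite !mxE; apply/eqP/oner_neq0.
have dv : \dim <[v]> = 1 by rewrite dim_vline v0.
by rewrite (omega_star n4 dv) card_star.
Qed.

(** * Cocliques *)

Lemma alpha_le : alpha (grassmann2 F n) * (q ^ 2 - 1) <= q ^ n - 1.
Proof.
have q1 := finNzRing_gt1 F.
have d0 : 0 < q ^ 2 - 1 by rewrite subn_gt0 -[X in X < _](expn0 q) ltn_exp2l.
rewrite -leq_divRL //; apply/bigmax_leqP=> A /cocliqueP cA; rewrite leq_divRL //.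
have := @incidence_le A 0%VS fullv 1; rewrite dimv0 dim_fullv muln1 expn0.
apply=> [|U _|v _]; rewrite ?sub0v ?subvf // memv0 => v0.
apply/card_le1_eqP=> U U'; rewrite !inE => /andP[AU Uv] /andP[AU' U'v].
apply/eqP; apply: contraNT (cA _ _ AU' AU) => neUU'.
by apply/adjP; split=> //; exists v.
Qed.

(** [J] makes the row space a vector space over the field [F[X]/(X^2 - X - b)] of [q ^ 2] elements.
    The invariant planes are its lines, a Desarguesian spread. *)
Lemma alpha_invariant_planes (J : 'M[F]_n) (b : F) :
    (J *m J = J + b%:M)%R -> (forall x : F, x * x != x + b)%R ->
  q ^ n - 1 <= alpha (grassmann2 F n) * (q ^ 2 - 1).
Proof.
move=> JJ irr.
have nvJ (v : V) : v != 0%R -> (v *m J)%R \notin <[v]>%VS.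
  (* An eigenvalue [k] of [J] would satisfy [k * k = k + b]. *)
  move=> v0; apply/vlineP=> -[k vJ]; have /eqP := congr1 (mulmx v) JJ.
  rewrite mulmxA vJ -scalemxAl vJ mulmxDr vJ mul_mx_scalar scalerA -scalerDl.
  by rewrite -subr_eq0 -scalerBl scaler_eq0 (negPf v0) subr_eq0 (negPf (irr k)).
have dv (v : V) : v != 0%R -> \dim <[v]> = 1 by move=> v0; rewrite dim_vline v0.
pose S : {set grassmann2 F n} :=
  [set U : plane F n | [forall v : V, (v \in val U) ==> ((v *m J)%R \in val U)]].
have SJ U v : U \in S -> v \in val U -> (v *m J)%R \in val U.
  by rewrite inE => /forallP/(_ v)/implyP.
apply: (@leq_trans (#|S| * (q ^ 2 - 1))); last first.
  rewrite leq_mul2r; apply/orP; right; apply: leq_bigmax_cond.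
  apply/cocliqueP=> U U' SU SU'; apply/adjP=> -[neUU' [v v0 [Uv U'v]]].
  have spanJ (X : plane F n) : X \in S -> v \in val X -> val X = (<[v]> + <[v *m J]>)%VS.
    move=> SX Xv; apply: (plane_spanned (dv v v0) (nvJ v v0)).
      by rewrite -memvE.
    exact: SJ SX Xv.
  by case/eqP: neUU'; apply: plane_inj; rewrite (spanJ U SU Uv) (spanJ U' SU' U'v).
have := @incidence_ge S 0%VS 1; rewrite dimv0 expn0 muln1; apply.
  by move=> U _; rewrite sub0v.
move=> v; rewrite memv0 => v0; apply/card_gt0P.
exists (Sub (<[v]> + <[v *m J]>)%VS (dim_line_add (dv v v0) (nvJ v v0))).
rewrite !inE /= memvE addvSl andbT; apply/forallP=> w; apply/implyP.
(* [J] sends [a v + c vJ] to [a vJ + c (vJ + b v)], again in the span. *)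
case/memv_addP=> x /vlineP[a ->] [y /vlineP[c ->] ->].
rewrite mulmxDl -!scalemxAl -mulmxA JJ mulmxDr mul_mx_scalar.
have vI : v \in (<[v]> + <[v *m J]>)%VS by rewrite memvE addvSl.
have vJI : (v *m J)%R \in (<[v]> + <[v *m J]>)%VS by rewrite memvE addvSr.
by rewrite !(rpredD, rpredZ).
Qed.

End Planes.

(* [x * x - x] takes the value 0 at both 0 and 1, hence omits some value. *)
Lemma quadratic_without_root (F : finFieldType) :
  exists b : F, forall x : F, (x * x != x + b)%R.
Proof.
pose f (x : F) := (x * x - x)%R.
have /existsP[b /codomP fb] : [exists b, b \notin codom f].
  rewrite -negb_forall; apply/forallP => fsurj.
  have finj : {in F &, injective f}.
    by apply/image_injP/eqP/eq_card=> b; rewrite inE; apply: fsurj.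
  have /eqP : (1 : F)%R = 0%R by apply: finj; rewrite // /f !(mul0r, mul1r, subrr).
  by rewrite oner_eq0.
by exists b => x; apply/eqP=> xx; apply: fb; exists x; rewrite /f xx addrC addKr.
Qed.

(** The block matrix is the companion matrix of [X^2 - X - b] with scalar blocks of size [m]. *)
Lemma alpha_even (F : finFieldType) (m : nat) :
  #|F| ^ (m + m) - 1 <= alpha (grassmann2 F (m + m)) * (#|F| ^ 2 - 1).
Proof.
have [b irr] := quadratic_without_root F.
apply: (@alpha_invariant_planes F _ (block_mx 0 1%:M b%:M 1%:M)%R b) irr.
rewrite mulmx_block !(mul0mx, mulmx0, mulmx1, mul1mx, add0r) -[(b%:M)%R in RHS]scalemx1.
by rewrite scalar_mx_block scalemx1 add_block_mx !(add0r, addr0) addrC.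
Qed.

Lemma alpha_odd_neq (F : finFieldType) (n : nat) : odd n ->
  alpha (grassmann2 F n) * (#|F| ^ 2 - 1) != #|F| ^ n - 1.
Proof.
move=> odd_n; have q1 := finNzRing_gt1 F; apply/eqP=> eq_n.
have : #|F| ^ 2 - 1 %| #|F| ^ n - 1 by rewrite -eq_n dvdn_mull.
(* Modulo [q ^ 2 - 1] the remainder is [q - 1], which is positive and less than [q ^ 2 - 1]. *)
have -> : #|F| ^ n - 1 = #|F| * ((#|F| ^ 2) ^ n./2 - 1 ^ n./2) + (#|F| - 1).
  rewrite exp1n -expnM mul2n -{1}(odd_double_half n) odd_n expnS.
  have : 0 < #|F| ^ (n./2).*2 by rewrite expn_gt0 ltnW.
  nia.
rewrite dvdn_addr; last by rewrite dvdn_mull // subn_exp dvdn_mulr.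
rewrite gtnNdvd ?subn_gt0 // expnS expn1; set r := #|F| in q1 *; nia.
Qed.

(** Here [w], [a] and [N] stand for omega, alpha and the number of planes. The hypotheses give
    [N * d = x * w] with [w] positive, so [w] cancels. *)
Lemma ltn_cofactor (a d e w x y N : nat) : 0 < d -> 0 < e -> 0 < y ->
  N * d * e = x * y -> w * e = y -> (w * a < N) = (a * d < x).
Proof.
move=> d0 e0 y0 Nxy wy; rewrite -[RHS](ltn_pmul2r y0) -Nxy -wy.
rewrite [in RHS]mulnA ltn_pmul2r // [in RHS]mulnAC ltn_pmul2r //.
by rewrite [w * a]mulnC.
Qed.

Theorem theorem3p3 (p k q n : nat) (F : finFieldType)
  (hp : prime p) (hk : 0 < k) (hq : q = p ^ k) (hF : #|F| = q) (hn : 4 <= n) :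
  separating (grassmann2 F n) <-> odd n.
Proof.
rewrite /separating; have q1 := finNzRing_gt1 F.
have d0 : 0 < #|F| ^ 2 - 1 by rewrite subn_gt0 -[X in X < _](expn0 #|F|) ltn_exp2l.
have e0 : 0 < #|F| ^ 2 - #|F| by rewrite subn_gt0 -[X in X < _]expn1 ltn_exp2l.
have N := card_planes F n; have w := omega_grassmann2 F hn.
have m0 : 0 < #|F| ^ n - #|F|.
  by rewrite subn_gt0 -[X in X < _]expn1 ltn_exp2l // (leq_trans _ hn).
rewrite (ltn_cofactor _ d0 e0 m0 N w).
(* Since [<=] always holds, separating means that the coclique bound is not attained. *)
rewrite ltn_neqAle alpha_le andbT; split=> [|odd_n]; last exact: alpha_odd_neq.
apply: contraR => even_n; rewrite eqn_leq alpha_le /=.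
(* The block matrix needs the dimension in the syntactic form [m + m]. *)
rewrite -(odd_double_half n) (negPf even_n) add0n -addnn; exact: alpha_even.
Qed.
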